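(* Let $(E_n)_{n\in\mathbb{N}}$ be a betting sequence with drift certificate $(c_n)$ and let $C_t\in\mathbb{R}$ be constants with $\sum_{n\le t}c_n\ge C_t$ $\mathbb{P}_1$-a.s. Assume there are a constant $s_0\in(0,\infty)$ and constants $\rho_n\in(0,\infty)$ such that $$\mathbb{E}_{\mathbb{P}_1}[E_n^{-s_0}\mid\mathcal{F}_{n-1}]\le\rho_n\qquad\mathbb{P}_1\text{-a.s., for every }n\in\mathbb{N}.$$ Put $\kappa_n:=\log\rho_n+s_0c_n\in[0,\infty)$, which is nonnegative by the conditional Jensen inequality, and let $K_t\in[0,\infty)$ be constants with $K_t\ge\sum_{n\le t}\kappa_n$. Then the chord $$\psi_n(s):=\frac{s}{s_0}\kappa_n\ \ (0\le s\le s_0),\qquad \psi_n(s):=+\infty\ \ (s>s_0),$$ is a majorant; its aggregate is $\Psi^{(t)}(s)=\frac{s}{s_0}K_t$ on $[0,s_0]$ and $+\infty$ beyond; the rate function is $$(\Psi^{(t)})^{\star}(x)=(s_0x-K_t)_+ ;$$ the optimising tilt is $s^{\ast}_t=s_0$ when $s_0\Delta_t>K_t$ and $s^{\ast}_t=0$ otherwise; and $$\bar\gamma_t(\alpha)\le\gamma_t(\alpha)\le\min\{1,\ \exp(K_t-s_0\Delta_t)\}.$$ If the $\rho_n$ are constants, so that $K_t=\sum_{n\le t}\kappa_n$ and $C_t=\sum_{n\le t}c_n$ are admissible together, the bound reads $$\gamma_t(\alpha)\le\min\Big\{1,\ \alpha^{-s_0}\prod_{n\le t}\rho_n\Big\}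.$$
   Context: Conventions: $\log$ is natural, $\log0=-\infty$, $0\cdot\infty=0$; for $x\in[0,\infty]$, $x^0=1$, and for $s>0$, $0^{-s}=+\infty$, $(+\infty)^{-s}=0$; $(x)_+=\max\{x,0\}$. Setting: $(\Omega,\mathcal{F})$ is a measurable space with a filtration $(\mathcal{F}_t)_{t\in\mathbb{N}_0}$, $\mathcal{F}_0=\{\emptyset,\Omega\}$, and $\mathbb{P}_0,\mathbb{P}_1$ are probability measures with $\mathbb{P}_1|_{\mathcal{F}_t}\ll\mathbb{P}_0|_{\mathcal{F}_t}$ for all $t$. A betting sequence is a family of $\mathcal{F}_n$-measurable maps $E_n:\Omega\to[0,\infty]$ with $\mathbb{E}_{\mathbb{P}_0}[E_n\mid\mathcal{F}_{n-1}]\le1$ $\mathbb{P}_0$-a.s. Wealth: $W_0=1$, $W_t=\prod_{n\le t}E_n$; $L_n:=\log E_n$. For $\alpha\in(0,1)$ and $t\in\mathbb{N}$: $\ell:=\log\frac1\alpha$, $\tau_\alpha:=\inf\{t\in\mathbb{N}:W_t>\frac1\alpha\}$, $\gamma_t(\alpha):=\mathbb{P}_1(W_t\le\frac1\alpha)$, $\bar\gamma_t(\alpha):=\mathbb{P}_1(\tau_\alpha>t)$. Drift certificate: real random variables $c_n$, $\mathcal{F}_{n-1}$-measurable, with $\mathbb{E}_{\mathbb{P}_1}[L_n\mid\mathcal{F}_{n-1}]\ge c_n$ $\mathbb{P}_1$-a.s. Put $\varphi_n(s):=\log\mathbb{E}_{\mathbb{P}_1}[e^{-s(L_n-c_n)}\mid\mathcal{F}_{n-1}]$.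 Majorant on $[0,s_{\max})$ (here $s_{\max}=\infty$): maps $\psi_n:[0,s_{\max})\times\Omega\to[0,\infty]$ with $\psi_n(s)$ $\mathcal{F}_{n-1}$-measurable, $\psi_n(0)=0$, and $\varphi_n(s)\le\psi_n(s)$ $\mathbb{P}_1$-a.s. for all $n$, $s$. Aggregate: deterministic $C_t\in\mathbb{R}$, $\Psi^{(t)}:[0,s_{\max})\to[0,\infty]$ with $\sum_{n\le t}c_n\ge C_t$ and $\sum_{n\le t}\psi_n(s)\le\Psi^{(t)}(s)$ $\mathbb{P}_1$-a.s. for all $t,s$. Inequalities between a constant and a sum of random variables are understood $\mathbb{P}_1$-a.s. $\Delta_t:=(C_t-\ell)_+$; rate function $(\Psi^{(t)})^{\star}(x):=\sup_{s\in[0,s_{\max})}\{sx-\Psi^{(t)}(s)\}$, $x\ge0$; an optimising tilt $s_t^{\ast}$ is a maximiser of this supremum at $x=\Delta_t$.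
   Formalization: κ_n ≥ 0 can fail when c_n is below E[L_n|F_{n-1}] (E_n=1, c_n=-1, ρ_n=s_0=1); it is proved a.s. where c_n equals E[L_n|F_{n-1}], and the chord is shown to be a majorant (nonnegative a.s.) assuming κ_n ≥ 0 a.s.; φ_n ≤ chord and all the other claims need no such assumption. *)

(* Defs.v *)
From mathcomp Require Import all_boot all_order all_algebra.
From mathcomp Require Import all_classical all_reals all_analysis.
From mathcomp Require Import measurable_realfun.

Set Implicit Arguments.
Unset Strict Implicit.
Unset Printing Implicit Defensive.

Import Order.TTheory GRing.Theory Num.Theory.
Import numFieldNormedType.Exports.

Local Open Scope classical_set_scope.
Local Open Scope ring_scope.
Local Open Scope ereal_scope.

(* Time-indexed families ([E], [c], [rho], ...) are functions on [nat] of which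
   only the values at n >= 1 matter; F_{n-1} is [F n.-1]. *)

Section ConditionalExpectation.
Context d (T : measurableType d) (R : realType).

Definition sub_measurable d' (U : measurableType d') (G : set (set T))
    (f : T -> U) : Prop :=
  forall B : set U, measurable B -> G (f @^-1` B).

Definition is_condexp (P : probability T R) (G : set (set T))
    (X Y : T -> \bar R) : Prop :=
  [/\ sub_measurable G Y,
      forall w, 0 <= Y w &
      forall A : set T, G A -> \int[P]_(w in A) Y w = \int[P]_(w in A) X w].

(* A chosen version of E_P[X | G] for measurable X : T -> [0, +oo] and a
   sub-sigma-algebra G.  No integrability is needed: such an X always has a
   version, unique up to P-null sets. *)
Definition condexp (P : probability T R) (G : set (set T)) (X : T -> \bar R)
    : T -> \bar R :=
  xget (cst 0) [set Y | is_condexp P G X Y].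

(* E_P[X | G] for signed X, as E_P[X^+ | G] - E_P[X^- | G].  Since
   +oo - +oo = -oo in [\bar R], a real lower bound on it at a point entails that
   E_P[X^- | G] is finite there, hence that the difference is meaningful. *)
Definition condexp_signed (P : probability T R) (G : set (set T))
    (X : T -> \bar R) (w : T) : \bar R :=
  condexp P G X^\+ w - condexp P G X^\- w.

End ConditionalExpectation.

Section Betting.
Context d (T : measurableType d) (R : realType).
Implicit Types (P : probability T R) (F : nat -> set (set T)).
Implicit Types (E : nat -> T -> \bar R) (c : nat -> T -> R).

Record filtration F : Prop := {
  filtration_sigma : forall t, sigma_algebra setT (F t);
  filtration_sub : forall t, F t `<=` measurable;
  filtration_mono : forall s t, (s <= t)%N -> F s `<=` F t;
  filtration0 : F 0%N = [set set0; setT] }.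

Definition locally_dominated F (P1 P0 : probability T R) : Prop :=
  forall t A, F t A -> P0 A = 0 -> P1 A = 0.

Record betting_sequence F P0 E : Prop := {
  betting_adapted : forall n, (0 < n)%N -> sub_measurable (F n) (E n);
  betting_ge0 : forall n w, (0 < n)%N -> 0 <= E n w;
  betting_condexp : forall n, (0 < n)%N ->
    {ae P0, forall w, condexp P0 (F n.-1) (E n) w <= 1} }.

(* [0 * +oo = 0] in [\bar R], which is the convention wanted here. *)
Definition wealth E (t : nat) (w : T) : \bar R :=
  \prod_(1 <= n < t.+1) E n w.

(* [lne 0 = -oo] and [lne +oo = +oo]. *)
Definition log_increment E (n : nat) (w : T) : \bar R := lne (E n w).

(* x^{-s}.  The library's [x `^ (- s)] is 0 at x = 0 and +oo at x = +oo; the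
   inverse of [x `^ s] is +oo and 0 there for s > 0, and 1 for s = 0. *)
Definition neg_pow (x : \bar R) (s : R) : \bar R := (x `^ s)^-1.

Definition log_threshold (alpha : R) : R := ln alpha^-1.

(* With values in {1, 2, ...} and +oo, the infimum of the empty set. *)
Definition tau E (alpha : R) (w : T) : \bar R :=
  ereal_inf [set (n%:R : R)%:E | n in
    [set n : nat | (0 < n)%N /\ (alpha^-1)%:E < wealth E n w]].

Definition gamma P1 E (alpha : R) (t : nat) : \bar R :=
  P1 [set w | wealth E t w <= (alpha^-1)%:E].

Definition gamma_bar P1 E (alpha : R) (t : nat) : \bar R :=
  P1 [set w | (t%:R : R)%:E < tau E alpha w].

Record drift_certificate F P1 E c : Prop := {
  drift_predictable : forall n, (0 < n)%N -> sub_measurable (F n.-1) (c n);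
  drift_condexp : forall n, (0 < n)%N ->
    {ae P1, forall w,
      (c n w)%:E <= condexp_signed P1 (F n.-1) (log_increment E n) w} }.

Definition phi F P1 E c (n : nat) (s : R) (w : T) : \bar R :=
  lne (condexp P1 (F n.-1)
         (fun v => expeR (- (s%:E * (log_increment E n v - (c n v)%:E)))) w).

(* Majorants and aggregates on [0, s_max) with s_max = +oo.  The range condition
   psi_n >= 0 is required P1-a.s., like the other inequalities: the sign of
   kappa_n below comes from a conditional Jensen inequality, hence up to null
   sets only. *)
Record majorant F P1 E c (psi : nat -> R -> T -> \bar R) : Prop := {
  majorant_predictable : forall n s, (0 < n)%N -> (0 <= s)%R ->
    sub_measurable (F n.-1) (psi n s);
  majorant_ge0 : forall n s, (0 < n)%N -> (0 <= s)%R ->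
    {ae P1, forall w, 0 <= psi n s w};
  majorant0 : forall n w, (0 < n)%N -> psi n 0%R w = 0;
  majorant_phi : forall n s, (0 < n)%N -> (0 <= s)%R ->
    {ae P1, forall w, phi F P1 E c n s w <= psi n s w} }.

Record aggregate P1 c (psi : nat -> R -> T -> \bar R)
    (C : nat -> R) (Psi : nat -> R -> \bar R) : Prop := {
  aggregate_drift : forall t, (0 < t)%N ->
    {ae P1, forall w, (C t <= \sum_(1 <= n < t.+1) c n w)%R};
  aggregate_ge0 : forall t s, (0 < t)%N -> (0 <= s)%R -> 0 <= Psi t s;
  aggregate_psi : forall t s, (0 < t)%N -> (0 <= s)%R ->
    {ae P1, forall w, \sum_(1 <= n < t.+1) psi n s w <= Psi t s} }.

Definition Delta (C : nat -> R) (alpha : R) (t : nat) : R :=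
  Num.max (C t - log_threshold alpha)%R 0%R.

Definition rate_function (Psi : R -> \bar R) (x : R) : \bar R :=
  ereal_sup [set (s * x)%:E - Psi s | s in [set s : R | (0 <= s)%R]].

Definition optimising_tilt (Psi : R -> \bar R) (x s : R) : Prop :=
  (0 <= s)%R /\ (s * x)%:E - Psi s = rate_function Psi x.

Definition kappa (rho : nat -> R) (s0 : R) c (n : nat) (w : T) : R :=
  (ln (rho n) + s0 * c n w)%R.

Definition chord (s0 : R) (kap : nat -> T -> R) (n : nat) (s : R) (w : T)
    : \bar R :=
  if (s <= s0)%R then (s / s0 * kap n w)%:E else +oo.

Definition chord_aggregate (s0 : R) (K : nat -> R) (t : nat) (s : R) : \bar R :=
  if (s <= s0)%R then (s / s0 * K t)%:E else +oo.

End Betting.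

(* Main.v *)
(* The constant rho_n dominates E[E_n^{-s0} | F_{n-1}] and yields everything.
   Put l = ln rho_n and th = s / s0.  The chord inequality
   e^{th y} <= 1 - th + th e^y at y = - s0 L_n - l bounds E_n^{-s} by an affine
   function of E_n^{-s0} whose conditional expectation is at most rho_n^th; the
   F_{n-1}-measurable factor e^{s c_n} can be carried along, which gives the
   majorant.  The tangent inequality - s0 L_n <= e^{- s0 L_n - l} - 1 + l gives
   kappa_n >= 0 after taking conditional expectations.  Iterating the conditional
   bound gives E[W_t^{-s0}] <= prod rho_n, and Markov's inequality applied to
   W_t^{-s0} gives the bound on gamma_t; the bound with K_t and C_t is weaker
   because K_t - s0 C_t >= sum ln rho_n. *)
Require Import Defs.
From mathcomp Require Import all_boot all_order all_algebra.
From mathcomp Require Import all_classical all_reals all_analysis.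
From mathcomp Require Import measurable_realfun.
From mathcomp Require Import ring lra.

Import Order.TTheory GRing.Theory Num.Theory.
Import numFieldNormedType.Exports.

Local Open Scope classical_set_scope.
Local Open Scope ring_scope.
Local Open Scope ereal_scope.

Set Implicit Arguments.
Unset Strict Implicit.

(** * Conditional expectation of nonnegative functions *)

Section SubSigmaAlgebra.
Context d (T : measurableType d) (R : realType) (P : probability T R).
Variable G : set (set T).
Hypotheses (sG : sigma_algebra setT G) (subG : G `<=` measurable).

Lemma measurable_g_sigma_algebraP (A : set T) :
  @measurable _ (g_sigma_algebraType G) A <-> G A.
Proof. by rewrite /measurable/= sigma_algebra_id. Qed.

(** Makes the closure lemmas for measurable functions available with [G] as the sigma-algebra of the
    source. *)
Lemma sub_measurableP d' (U : measurableType d') (f : T -> U) :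
  sub_measurable G f <->
  measurable_fun [set: g_sigma_algebraType G] (f : g_sigma_algebraType G -> U).
Proof.
split=> mf.
  by move=> _ B mB; rewrite setTI; apply/measurable_g_sigma_algebraP; exact: mf.
move=> B mB; apply/measurable_g_sigma_algebraP.
by rewrite -[X in measurable X]setTI; exact: mf.
Qed.

Lemma sub_measurable_fun d' (U : measurableType d') (f : T -> U) :
  sub_measurable G f -> measurable_fun setT f.
Proof. by move=> mf _ B mB; rewrite setTI; apply/subG/mf. Qed.

(** Pushing [P] forward along this map restricts it to [G]. *)
Lemma measurable_id_sub :
  measurable_fun setT (id : T -> g_sigma_algebraType G).
Proof.
by move=> _ B /measurable_g_sigma_algebraP GB; rewrite setTI; exact: subG.
Qed.

(* Radon-Nikodym for the restrictions to G of P and of the measure X . P. *)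
Lemma is_condexp_exists_bounded (X : T -> \bar R) : measurable_fun setT X ->
  (forall w, 0 <= X w <= 1) -> exists Y, is_condexp P G X Y.
Proof.
move=> mX X01.
have X0 w : 0 <= X w by case/andP: (X01 w).
have iX : P.-integrable setT X.
  apply: (@le_integrable _ _ _ P setT measurableT X (cst 1)) => //.
    by move=> w _; have /andP[? ?] := X01 w; rewrite /= gee0_abs// normr1.
  exact: (finite_measure_integrable_cst P 1%R).
pose idm :=
  mfun_Sub (mem_set (measurable_id_sub : [set f | measurable_fun setT f] _)).
pose mu : probability (g_sigma_algebraType G) R := distribution P idm.
have [nu nuE] : exists nu : {charge set (g_sigma_algebraType G) -> \bar R},
    forall A, nu A = \int[P]_(w in A) X w.
  unshelve eexists
    (pushforward (induced_charge iX) (id : T -> g_sigma_algebraType G)).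
    exact: measurable_id_sub.
  by [].
have numu : nu `<< mu.
  apply/null_content_dominatesP => A /measurable_g_sigma_algebraP GA PA0.
  by rewrite nuE null_set_integral//; [exact: subG|exact: measurable_funTS].
pose f := Radon_Nikodym nu mu.
have fE A : G A -> \int[P]_(w in A) X w = \int[mu]_(w in A) f w.
  move=> /measurable_g_sigma_algebraP GA.
  by rewrite -nuE (Radon_Nikodym_integral numu).
have mf : measurable_fun setT f.
  by apply: measurable_int (Radon_Nikodym_integrable numu).
(* The chosen derivative [f] may be negative at some points, whereas [is_condexp] demands
   nonnegativity everywhere; hence the version [f^\+]. *)
pose B := [set w | 0 <= f w].
have mB : G B.
  apply/measurable_g_sigma_algebraP; rewrite /B -[X in measurable X]setTI.
  exact: emeasurable_fun_c_infty.
exists (f^\+); split.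
- by apply/sub_measurableP; exact: measurable_funepos.
- by move=> w; exact: funepos_ge0.
move=> A GA.
have mA : @measurable _ (g_sigma_algebraType G) A.
  exact/measurable_g_sigma_algebraP.
have mB' : @measurable _ (g_sigma_algebraType G) B.
  exact/measurable_g_sigma_algebraP.
have mAB : G (A `&` B) by apply/measurable_g_sigma_algebraP; exact: measurableI.
have mADB : G (A `\` B) by apply/measurable_g_sigma_algebraP; exact: measurableD.
have -> : \int[P]_(w in A) f^\+ w = \int[mu]_(w in A) f^\+ w.
  rewrite ge0_integral_pushforward//.
  exact/measurable_funTS/measurable_funepos.
have -> : \int[mu]_(w in A) f^\+ w = \int[mu]_(w in A `&` B) f w.
  rewrite integral_mkcondr; apply: eq_integral => w _.
  rewrite /patch funeposE; have [fw|/negP fw] := boolP (0 <= f w).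
    by rewrite mem_set//; apply/max_idPl.
  by rewrite memNset//; apply/max_idPr; rewrite ltW// ltNge; exact/negP.
rewrite -fE// -[in RHS](setUIDK A B) ge0_integral_setU//; last 4 first.
- exact: subG.
- exact: subG.
- exact: measurable_funTS.
- by rewrite disj_set2E; apply/eqP; rewrite -subset0 => w [[_ Bw] [_ /(_ Bw)]].
(* Off [B] the integral of [f] is at most 0 and that of [X] at least 0; they agree on sets of [G],
   so both vanish. *)
rewrite [X in _ + X](_ : _ = 0) ?adde0//.
apply/eqP; rewrite eq_le integral_ge0 // andbT fE//.
rewrite integralE (_ : \int[mu]_(w in A `\` B) f^\+ w = 0).
  by rewrite sub0e oppe_le0 integral_ge0.
apply: integral0_eq => w [_ /negP]; rewrite -ltNge => fw.
by rewrite funeposE; apply/max_idPr/ltW.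
Qed.

(* Reduces the existence of conditional expectations to the bounded case, also
   where X = +oo. *)
Lemma sum_unit_layers (x : \bar R) : 0 <= x ->
  \sum_(k <oo) maxe 0 (mine 1 (x - k%:R%:E)) = x.
Proof.
move=> x0.
have partial n : \sum_(0 <= k < n) maxe 0 (mine 1 (x - k%:R%:E)) = mine x n%:R%:E.
  elim: n => [|n IH]; first by rewrite big_geq//; apply/esym/min_idPr.
  rewrite big_nat_recr//= IH -[in RHS]natr1.
  case: x x0 {IH} => [r| |//] x0.
    rewrite -EFinB -!EFin_min -EFin_max -EFinD; congr EFin.
    by rewrite /Order.min /Order.max; do !case: ifPn; rewrite -?leNgt => *; lra.
  rewrite addye// !minye miney.
  by have -> : maxe 0 1 = 1 :> \bar R by exact/max_idPr/lee01.
apply: cvg_lim => //=; under eq_fun do rewrite partial.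
case: x x0 {partial} => [r| |//] x0.
  apply: cvg_near_cst; near=> n.
  apply/min_idPl; rewrite lee_fin ltW//; near: n; exact: nbhs_infty_gtr.
under eq_fun do rewrite minye.
exact/cvgenyP.
Unshelve. all: by end_near. Qed.

(** Each unit layer of [X] takes values in [0, 1] and has a version; by monotone convergence the sum
    of these versions is a version for [X]. *)
Lemma is_condexp_exists (X : T -> \bar R) : measurable_fun setT X ->
  (forall w, 0 <= X w) -> exists Y, is_condexp P G X Y.
Proof.
move=> mX X0.
pose Xk k w := maxe 0 (mine 1 (X w - k%:R%:E)).
have mXk k : measurable_fun setT (Xk k).
  apply: measurable_maxe => //; apply: measurable_mine => //.
  exact: emeasurable_funB.
have Xk0 k w : 0 <= Xk k w by rewrite le_max lexx.
have /choice[Y HY] k : exists Y, is_condexp P G (Xk k) Y.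
  apply: is_condexp_exists_bounded => // w.
  by rewrite Xk0/= ge_max lee01/= ge_min lexx.
have mY k : measurable_fun [set: g_sigma_algebraType G] (Y k).
  by apply/sub_measurableP; case: (HY k).
have Y0 k w : 0 <= Y k w by case: (HY k).
exists (fun w => \sum_(k <oo) Y k w); split.
- apply/sub_measurableP; exact: ge0_emeasurable_sum.
- by move=> w; exact: nneseries_ge0.
- move=> A GA; have mA := subG GA.
  transitivity (\int[P]_(w in A) \sum_(k <oo) Xk k w); last first.
    by apply: eq_integral => w _; rewrite sum_unit_layers.
  rewrite !integral_nneseries//; last 2 first.
  + by move=> n; apply: measurable_funTS; exact: mXk.
  + by move=> n; apply/measurable_funTS/sub_measurable_fun/sub_measurableP.
  by apply: eq_eseriesr => k _; case: (HY k) => _ _; exact.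
Qed.

Lemma condexpP (X : T -> \bar R) : measurable_fun setT X ->
  (forall w, 0 <= X w) -> is_condexp P G X (condexp P G X).
Proof. by move=> mX X0; exact: xgetPex (is_condexp_exists mX X0). Qed.

End SubSigmaAlgebra.

(** * Comparing integrals over the sets of a sub-sigma-algebra *)

Section IntegralComparison.
Context d (T : measurableType d) (R : realType) (P : probability T R).
Variable G : set (set T).
Hypotheses (sG : sigma_algebra setT G) (subG : G `<=` measurable).

(** The set where [Z < Y] is cut into sets of [G] on which [Z] is bounded; over each of them [Y - Z]
    is positive with integral at most 0, so each is null. *)
Lemma ae_le_of_integral_le (Y Z : T -> \bar R) :
  sub_measurable G Y -> sub_measurable G Z ->
  (forall w, 0 <= Y w) -> (forall w, 0 <= Z w) ->
  (forall A, G A -> \int[P]_(w in A) Y w <= \int[P]_(w in A) Z w) ->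
  {ae P, forall w, Y w <= Z w}.
Proof.
move=> GY GZ Y0 Z0 YZ.
have mY := sub_measurable_fun subG GY; have mZ := sub_measurable_fun subG GZ.
pose N k := [set w | Z w < Y w] `&` [set w | Z w <= k%:R%:E].
(* Restricting to Z <= k makes Y - Z a genuine difference. *)
have GN k : G (N k).
  apply/(measurable_g_sigma_algebraP sG).
  move: GY GZ => /(sub_measurableP sG) GY /(sub_measurableP sG) GZ.
  apply: measurableI; rewrite -[X in measurable X]setTI.
    exact: measurable_lte.
  exact: measurable_lee.
have N0 k : P.-negligible (N k).
  have mN := subG (GN k).
  have YZ0 w : N k w -> 0 <= Y w - Z w.
    move=> [/= zy zk]; rewrite sube_ge0 ?ltW//.
    by rewrite ge0_fin_numE// (le_lt_trans zk)// ltry.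
  have ZN : \int[P]_(w in N k) Z w \is a fin_num.
    rewrite ge0_fin_numE ?integral_ge0//.
    apply: (@le_lt_trans _ _ (\int[P]_(w in N k) cst k%:R%:E w)).
      apply: ge0_le_integral => //.
      - exact: measurable_funTS.
      - by move=> w [].
    rewrite integral_cst//= lte_mul_pinfty ?lee_fin//.
    by rewrite -ge0_fin_numE ?fin_num_measure.
  have D0 : \int[P]_(w in N k) (Y w - Z w) = 0.
    apply/eqP; rewrite eq_le integral_ge0// andbT.
    rewrite -(leeD2lE _ _ ZN) adde0 -ge0_integralD//; last 2 first.
    - exact: measurable_funTS.
    - exact/measurable_funTS/emeasurable_funB.
    apply: le_trans (YZ _ (GN k)).
    rewrite le_eqVlt; apply/orP; left; apply/eqP; apply: eq_integral => w.
    rewrite inE => -[/= zy zk]; rewrite addeC subeK//.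
    by rewrite ge0_fin_numE// (le_lt_trans zk)// ltry.
  have : ae_eq P (N k) (fun w => Y w - Z w) (cst 0).
    apply/ae_eq_integral_abs => //.
      exact/measurable_funTS/emeasurable_funB.
    rewrite -[RHS]D0; apply: eq_integral => w; rewrite inE => Nw.
    by rewrite gee0_abs// YZ0.
  apply: negligibleS => w Nw /= /(_ Nw) /eqP; apply/negP.
  case: Nw => /= zy zk; rewrite gt_eqF// sube_gt0//.
have : P.-negligible (\bigcup_k N k) by exact: negligible_bigcup.
apply: negligibleS => w /= /negP; rewrite -ltNge => zy.
(* [Z w < Y w] makes [Z w] finite, so [w] lies in some [N k]. *)
have Zfin : Z w \is a fin_num by rewrite ge0_fin_numE// (lt_le_trans zy)// leey.
exists (Num.truncn (fine (Z w))).+1 => //; split => //=.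
by rewrite -(fineK Zfin) lee_fin ltW// truncnS_gt.
Qed.

Import HBNNSimple.

(** Reduces a simple [G]-measurable weight to integrals of [X] over sets of [G], the only integrals
    on which a comparison is assumed later. *)
Lemma integral_mul_simple (h : {nnsfun g_sigma_algebraType G >-> R})
    (X : T -> \bar R) A :
  measurable_fun setT X -> (forall w, 0 <= X w) -> G A ->
  \int[P]_(w in A) ((h w)%:E * X w) =
  \sum_(y \in range h) y%:E * \int[P]_(w in A `&` h @^-1` [set y]) X w.
Proof.
move=> mX X0 GA; have mA := subG GA.
have mh y : measurable (h @^-1` [set y] : set T).
  apply: subG; apply/(measurable_g_sigma_algebraP sG); exact: measurable_sfunP.
have mi y : measurable_fun A (fun w : T => (y * \1_(h @^-1` [set y]) w)%:E).
  apply/measurable_EFinP/measurable_funM => //; exact: measurable_indic.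
transitivity (\int[P]_(w in A) (\sum_(y \in range h)
    (y * \1_(h @^-1` [set y]) w)%:E * X w)).
  apply: eq_integral => w _.
  rewrite -ge0_mule_fsuml => [|y]; last by rewrite EFinM; exact: nnfun_muleindic_ge0.
  by rewrite fsumEFin // -(fimfunE h w).
rewrite ge0_integral_fsum//; last 2 first.
- by move=> y; apply: emeasurable_funM => //; exact: measurable_funTS.
- by move=> y w Aw; rewrite mule_ge0// EFinM nnfun_muleindic_ge0.
apply: eq_fsbigr => y; rewrite inE => -[v _ hv].
rewrite integral_mkcondr -ge0_integralZl//; last 3 first.
- by apply: (measurable_restrict X (mh y) mA).1; exact: measurable_funTS.
- by move=> w _; apply: erestrict_ge0.
- by rewrite -hv lee_fin.
by apply: eq_integral => w _; rewrite epatch_indic/= EFinM -muleA [X w * _]muleC.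
Qed.

(** Stands in for pulling a [G]-measurable factor out of a conditional expectation. Simple weights
    come from [integral_mul_simple]; increasing approximations of [f] and monotone convergence on
    the [X] side do the rest. *)
Lemma integral_mul_le (f X Z : T -> \bar R) A :
  sub_measurable G f -> (forall w, 0 <= f w) ->
  measurable_fun setT X -> (forall w, 0 <= X w) ->
  measurable_fun setT Z -> (forall w, 0 <= Z w) ->
  (forall B, G B -> \int[P]_(w in B) X w <= \int[P]_(w in B) Z w) ->
  G A -> \int[P]_(w in A) (f w * X w) <= \int[P]_(w in A) (f w * Z w).
Proof.
move=> Gf f0 mX X0 mZ Z0 XZ GA; have mA := subG GA.
have mf := sub_measurable_fun subG Gf.
have mf' : measurable_fun [set: g_sigma_algebraType G] f by apply/sub_measurableP.
pose h := nnsfun_approx measurableT mf'.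
have hf w : EFin \o h^~ w @ \oo --> f w by apply: cvg_nnsfun_approx.
have hnd w : nondecreasing_seq (fun n => (h n w)%:E).
  by move=> m n mn; rewrite lee_fin; exact/lefP/nd_nnsfun_approx.
have hle n w : (h n w)%:E <= f w.
  rewrite (cvg_unique _ (hf w) (ereal_nondecreasing_cvgn (hnd w)))//.
  by apply: ereal_sup_ubound; exists n.
have mh n : measurable_fun setT (fun w : T => (h n w)%:E).
  apply/(sub_measurable_fun subG)/(sub_measurableP sG).
  by apply/measurable_EFinP.
have -> : \int[P]_(w in A) (f w * X w) =
    \int[P]_(w in A) limn (fun n => (h n w)%:E * X w).
  apply: eq_integral => w _; apply/esym/cvg_lim => //.
  (* Multiplication is discontinuous at [0 * +oo]; when the product is 0, the approximations lie
     between 0 and it, hence are constantly 0. *)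
  have [fX0|fX0] := eqVneq (f w * X w) 0; last first.
    exact: (cvgeM (neq0_mule_def fX0) (hf w) (cvg_cst _)).
  have -> : (fun n => (h n w)%:E * X w) = cst 0; last by rewrite fX0; exact: cvg_cst.
  apply/funext => n /=; apply/eqP; rewrite eq_le mule_ge0 ?lee_fin// andbT -fX0.
  by rewrite lee_wpmul2r.
rewrite monotone_convergence//; last 3 first.
- by move=> n; apply/measurable_funTS/emeasurable_funM.
- by move=> n w _; rewrite mule_ge0// lee_fin.
- by move=> w _ m n mn; rewrite lee_wpmul2r// hnd.
apply: lime_le.
  apply: ereal_nondecreasing_is_cvgn => m n mn.
  apply: ge0_le_integral => //.
  - by move=> w _; rewrite mule_ge0// lee_fin.
  - exact/measurable_funTS/emeasurable_funM.
  - exact/measurable_funTS/emeasurable_funM.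
  - by move=> w _; rewrite lee_wpmul2r// hnd.
apply: nearW => n.
apply: (@le_trans _ _ (\int[P]_(w in A) ((h n w)%:E * Z w))).
  rewrite !integral_mul_simple//; apply: lee_fsum => // y [v _ <-].
  rewrite lee_wpmul2l ?lee_fin//; apply: XZ.
  apply/(measurable_g_sigma_algebraP sG); apply: measurableI.
    exact/(measurable_g_sigma_algebraP sG).
  exact: measurable_sfunP.
apply: ge0_le_integral => //.
- by move=> w _; rewrite mule_ge0// lee_fin.
- exact/measurable_funTS/emeasurable_funM.
- exact/measurable_funTS/emeasurable_funM.
- by move=> w _; rewrite lee_wpmul2r// hle.
Qed.

End IntegralComparison.

(** * Extended real inequalities *)

Section ExtendedReal.
Context (R : realType).

(** The two infinite points are measurable singletons, so only the restriction to the reals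
    matters. *)
Lemma measurable_fun_EFin_comp d (T : measurableType d) (g : \bar R -> T) :
  measurable_fun [set: R] (g \o EFin) -> measurable_fun [set: \bar R] g.
Proof.
move=> mg; rewrite (_ : g = fun x => if x \is a fin_num then (g \o EFin) (fine x)
  else if x == +oo then g +oo else g -oo); last by apply/funext; case.
apply: measurable_fun_ifT => /=.
- by apply: (measurable_fun_bool true); exact: emeasurable_fin_num.
- exact: (measurableT_comp mg (fine_measurable measurableT)).
- by apply: measurable_fun_ifT => //; exact: measurable_fun_eqe.
Qed.

Lemma measurable_lne : measurable_fun [set: \bar R] (@lne R).
Proof.
apply: measurable_fun_EFin_comp; apply: measurable_fun_ifT => //=.
- exact: measurable_fun_ler.
- by apply/measurable_EFinP; exact: measurable_ln.
Qed.

Lemma measurable_expeR : measurable_fun [set: \bar R] (@expeR R).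
Proof.
by apply/measurable_fun_EFin_comp/measurable_EFinP; exact: measurable_expR.
Qed.

Lemma neg_powE (x : \bar R) (s : R) : (0 < s)%R -> 0 <= x ->
  neg_pow x s = expeR (- (s%:E * lne x)).
Proof.
move=> s0; case: x => [r| |//] x0; rewrite /neg_pow.
- move: x0; rewrite lee_fin le_eqVlt => /predU1P[<-|r0].
    by rewrite poweR0r ?gt_eqF// inve0 le0_lneNy// mulrNy gtr0_sg// mul1e/=.
  rewrite lne_EFin//= inver powR_eq0 gt_eqF//= /powR gt_eqF//.
  by rewrite -expRN.
- by rewrite poweRyr ?gt_eqF// invey /= gt0_muley ?lte_fin.
Qed.

Lemma neg_pow_ge0 (x : \bar R) (s : R) : 0 <= neg_pow x s.
Proof. by rewrite inve_ge0 poweR_ge0. Qed.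

(** Positivity excludes the pair 0 and [+oo], for which the left side would be [+oo] and the right
    side 0. *)
Lemma neg_powM (x y : \bar R) (s : R) : (0 < s)%R -> 0 < x -> 0 < y ->
  neg_pow (x * y) s = neg_pow x s * neg_pow y s.
Proof.
move=> s0 x0 y0; rewrite !neg_powE ?mule_ge0 1?ltW//.
rewrite lneM ?in_itv/= ?x0 ?y0 ?leey// -expeRD; congr expeR.
have lneNy (z : \bar R) : 0 < z -> lne z != -oo.
  by case: z => [r| |//] //; rewrite lte_fin => r0; rewrite lne_EFin.
move: (lne x) (lne y) (lneNy _ x0) (lneNy _ y0) => [a| |] [b| |] //= _ _.
- by congr EFin; ring.
- by rewrite addey// gt0_muley ?lte_fin// addeNy.
- by rewrite addye// gt0_muley ?lte_fin// addNye.
- by rewrite addye// gt0_muley ?lte_fin// addNye.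
Qed.

Lemma expR_chord (th y : R) : (0 <= th <= 1)%R ->
  (expR (th * y) <= 1 - th + th * expR y)%R.
Proof.
move=> /andP[th0 th1].
(* Both endpoints lie above the tangent at th * y. *)
have h1 : ((1 + (1 - th) * y) * expR (th * y) <= expR y)%R.
  rewrite [leRHS](_ : _ = expR ((1 - th) * y) * expR (th * y))%R.
    by rewrite ler_pM2r ?expR_gt0// expR_ge1Dx.
  by rewrite -expRD; congr expR; ring.
have h2 : ((1 - th * y) * expR (th * y) <= 1)%R.
  rewrite [leRHS](_ : _ = expR (- (th * y)) * expR (th * y))%R.
    by rewrite ler_pM2r ?expR_gt0// expR_ge1Dx.
  by rewrite -expRD addNr expR0.
(* With weights [th] and [1 - th] the terms in [y] cancel and the factors of [expR (th * y)] add up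
   to 1. *)
have := ler_wpM2l th0 h1.
have : ((1 - th) * ((1 - th * y) * expR (th * y)) <= (1 - th) * 1)%R.
  by apply: ler_wpM2l => //; lra.
set e := expR (th * y); set e' := expR y.
by move=> ? ?; lra.
Qed.

(** This is [expR_chord] at slope [s / s0] and point [- (s0 * x) - l], multiplied by
    [expR (s * c + s / s0 * l)]. The parameter [l] is free here and becomes [ln rho]. *)
Lemma expeR_affine_le (x : \bar R) (c s s0 l : R) : (0 < s0)%R ->
  (0 <= s <= s0)%R ->
  expeR (- (s%:E * (x - c%:E))) <=
  (expR (s * c))%:E * ((expR (s / s0 * l) * (1 - s / s0))%:E +
     (expR (s / s0 * l) * (s / s0) * expR (- l))%:E * expeR (- (s0%:E * x))).
Proof.
(* At [s = 0] both sides are 1, by [0 * +oo = 0]. For [s > 0] the coefficient of the exponential is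
   positive, which settles infinite [x]. *)
move=> s0_gt0 /andP[]; rewrite le_eqVlt => /predU1P[<- _|s_gt0 ss0].
  rewrite !(mul0r, expR0, subr0, mulr1, mulr0) !mul0e oppe0 expeR0 adde0.
  by rewrite mule1.
have th_gt0 : (0 < s / s0)%R by rewrite divr_gt0.
have th1 : (s / s0 <= 1)%R by rewrite ler_pdivrMr// mul1r.
case: x => [r| |].
- have := @expR_chord (s / s0) (- (s0 * r) - l).
  rewrite (ltW th_gt0) th1 => /(_ isT) h.
  rewrite /= lee_fin.
  have -> : (- (s * (r - c)) =
      s * c + (s / s0 * l + s / s0 * (- (s0 * r) - l)))%R.
    by field; rewrite gt_eqF.
  rewrite !expRD ler_pM2l ?expR_gt0//.
  move: (s / s0)%R th_gt0 th1 h => th _ _ h.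
  rewrite -!mulrA -mulrDr ler_pM2l ?expR_gt0//.
  by rewrite -expRD [(- l + _)%R]addrC.
- rewrite /= !gt0_muley ?lte_fin//= mule0 adde0 lee_fin.
  by apply: mulr_ge0; [|apply: mulr_ge0]; rewrite ?expR_ge0// subr_ge0.
- rewrite /= !gt0_muleNy ?lte_fin//= [in leRHS]gt0_muley; last first.
    by rewrite lte_fin; apply: mulr_gt0; [apply: mulr_gt0|]; rewrite ?expR_gt0.
  by rewrite addey// gt0_muley ?lte_fin ?expR_gt0// leey.
Qed.

(* This is [- s x <= e^{- s x - l} - 1 + l], with the positive part of x and m
   moved to the right so that no +oo - +oo can occur. *)
Lemma neg_part_le_expeR (x : \bar R) (s l p m : R) : (0 < s)%R ->
  (p - m = 1 - l)%R ->
  p%:E + s%:E * maxe (- x) 0 <=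
  (m%:E + (expR (- l))%:E * expeR (- (s%:E * x))) + s%:E * maxe x 0.
Proof.
move=> s_gt0 pm; case: x => [r| |].
- rewrite /= -!EFin_max -!EFinM -!EFinD lee_fin -expRD.
  have := expR_ge1Dx (- l + - (s * r)); set e := expR _ => h.
  have -> : (s * Num.max (- r) 0 = s * Num.max r 0 - s * r)%R.
    by rewrite /Num.max; case: ifPn; case: ifPn; rewrite -?leNgt => ? ?; nra.
  by lra.
- by rewrite (_ : maxe +oo 0 = +oo) // gt0_muley ?lte_fin//= mule0 adde0 leey.
- rewrite gt0_muleNy ?lte_fin//= gt0_muley ?lte_fin ?expR_gt0// addey//.
  rewrite (max_idPr (leNye 0)).
  by rewrite mule0 adde0 gt0_muley ?lte_fin ?expR_gt0.
Qed.

End ExtendedReal.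

(** * One betting round *)

Section OneStep.
Context d (T : measurableType d) (R : realType) (P : probability T R).
Variable G : set (set T).
Hypotheses (sG : sigma_algebra setT G) (subG : G `<=` measurable).

(** With [condexp_le], translates between almost sure bounds on conditional expectations and bounds
    on integrals over sets of [G]. *)
Lemma integral_le_of_condexp_le (X Z : T -> \bar R) A :
  measurable_fun setT X -> (forall w, 0 <= X w) ->
  measurable_fun setT Z -> (forall w, 0 <= Z w) ->
  {ae P, forall w, condexp P G X w <= Z w} ->
  G A -> \int[P]_(w in A) X w <= \int[P]_(w in A) Z w.
Proof.
move=> mX X0 mZ Z0 XZ GA.
have [GY Y0 YE] := condexpP P sG subG mX X0.
rewrite -YE//; apply: ae_ge0_le_integral => //.
- exact: subG.
- exact/measurable_funTS/(sub_measurable_fun subG).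
- exact: measurable_funTS.
- by apply: filterS XZ => w.
Qed.

Lemma condexp_le (X Z : T -> \bar R) :
  measurable_fun setT X -> (forall w, 0 <= X w) ->
  sub_measurable G Z -> (forall w, 0 <= Z w) ->
  (forall A, G A -> \int[P]_(w in A) X w <= \int[P]_(w in A) Z w) ->
  {ae P, forall w, condexp P G X w <= Z w}.
Proof.
move=> mX X0 GZ Z0 XZ.
have [GY Y0 YE] := condexpP P sG subG mX X0.
by apply: (ae_le_of_integral_le sG subG) => // A GA; rewrite YE// XZ.
Qed.

Lemma sub_measurable_comp d1 d2 (U : measurableType d1) (V : measurableType d2)
    (g : U -> V) (f : T -> U) :
  measurable_fun setT g -> sub_measurable G f -> sub_measurable G (g \o f).
Proof.
move=> mg mf B mB; rewrite comp_preimage; apply: mf.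
by rewrite -[X in measurable X]setTI; exact: mg.
Qed.

Variables (X : T -> \bar R) (s0 rho : R).
Hypotheses (mX : measurable_fun setT X) (X0 : forall w, 0 <= X w).
Hypotheses (s0_gt0 : (0 < s0)%R) (rho_gt0 : (0 < rho)%R).
Hypothesis Xrho :
  {ae P, forall w, condexp P G (fun v => neg_pow (X v) s0) w <= rho%:E}.

Lemma measurable_neg_pow s : (0 < s)%R ->
  measurable_fun setT (fun w => neg_pow (X w) s).
Proof.
move=> s_gt0; under eq_fun do rewrite neg_powE//.
apply: (measurableT_comp (@measurable_expeR R)).
apply: measurableT_comp => //; apply: measurable_funeM.
exact: (measurableT_comp (@measurable_lne R)).
Qed.

Lemma integral_neg_pow_le A : G A ->
  \int[P]_(w in A) neg_pow (X w) s0 <= \int[P]_(w in A) cst rho%:E w.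
Proof.
apply: integral_le_of_condexp_le => //.
- exact: measurable_neg_pow.
- by move=> w; exact: neg_pow_ge0.
- by move=> w; rewrite lee_fin ltW.
Qed.

Lemma integral_affine_neg_pow_le (a b : R) A : (0 <= a)%R -> (0 <= b)%R -> G A ->
  \int[P]_(w in A) (a%:E + b%:E * neg_pow (X w) s0) <=
  \int[P]_(w in A) cst (a + b * rho)%:E w.
Proof.
move=> a0 b0 GA; have mA := subG GA; have mN := measurable_neg_pow s0_gt0.
rewrite ge0_integralD//; last 2 first.
- by move=> w _; rewrite mule_ge0 ?lee_fin// neg_pow_ge0.
- exact/measurable_funTS/measurable_funeM.
rewrite ge0_integralZl//; last 2 first.
- exact: measurable_funTS.
- by move=> w _; exact: neg_pow_ge0.
have -> : \int[P]_(w in A) cst (a + b * rho)%:E w =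
    \int[P]_(w in A) cst a%:E w + b%:E * \int[P]_(w in A) cst rho%:E w.
  rewrite !integral_cst// EFinD EFinM muleA ge0_muleDl//.
  by rewrite lee_fin mulr_ge0// ltW.
by rewrite leeD2l// lee_wpmul2l// integral_neg_pow_le.
Qed.

(** The exponent on the right is [s / s0] times [ln rho + s0 * c w], which is the chord of
    [kappa]. *)
Lemma condexp_exp_le (c : T -> R) (s : R) : sub_measurable G c ->
  (0 <= s <= s0)%R ->
  {ae P, forall w, condexp P G
    (fun v => expeR (- (s%:E * (lne (X v) - (c v)%:E)))) w <=
    (expR (s * c w + s / s0 * ln rho))%:E}.
Proof.
move=> Gc /andP[s_ge0 ss0].
pose th := (s / s0)%R; pose l := ln rho.
have th01 : (0 <= th <= 1)%R.
  by rewrite /th divr_ge0 ?(ltW s0_gt0)//= ler_pdivrMr// mul1r.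
have [th0 th1] := andP th01.
(* The coefficients of [expeR_affine_le] at [l = ln rho]; with this choice [a + b * rho] collapses
   to [rho] to the power [th]. *)
pose a := (expR (th * l) * (1 - th))%R; pose b := (expR (th * l) * th * expR (- l))%R.
have a0 : (0 <= a)%R by rewrite mulr_ge0 ?expR_ge0// subr_ge0.
have b0 : (0 <= b)%R by do 2?[apply: mulr_ge0]; rewrite ?expR_ge0.
have abE : (a + b * rho = expR (th * l))%R.
  by rewrite /b expRN lnK// divfK ?gt_eqF// /a -mulrDr subrK mulr1.
pose f w := (expR (s * c w))%:E.
have Gf : sub_measurable G f.
  apply: (sub_measurable_comp (g := fun x : R => (expR (s * x))%:E)) => //.
  apply/measurable_EFinP; apply: (measurableT_comp (@measurable_expR R)).
  exact: measurable_funM.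
have f0 w : 0 <= f w by rewrite lee_fin expR_ge0.
have mc := sub_measurable_fun subG Gc.
have mN := measurable_neg_pow s0_gt0.
apply: condexp_le.
- apply: (measurableT_comp (@measurable_expeR R)).
  apply: measurableT_comp => //; apply: measurable_funeM.
  apply: emeasurable_funB; first exact: (measurableT_comp (@measurable_lne R)).
  exact/measurable_EFinP.
- by move=> w; exact: expeR_ge0.
- apply: (sub_measurable_comp
    (g := fun x : R => (expR (s * x + s / s0 * ln rho))%:E)) => //.
  apply/measurable_EFinP; apply: (measurableT_comp (@measurable_expR R)).
  by apply: measurable_funD => //; exact: measurable_funM.
- by move=> w; rewrite lee_fin expR_ge0.
move=> A GA; have mA := subG GA; have mf := sub_measurable_fun subG Gf.
have mab : measurable_fun setT (fun w => a%:E + b%:E * neg_pow (X w) s0).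
  by apply: emeasurable_funD => //; exact: measurable_funeM.
have ab0 w : 0 <= a%:E + b%:E * neg_pow (X w) s0.
  by rewrite adde_ge0// ?mule_ge0// ?lee_fin// neg_pow_ge0.
(* First the pointwise affine bound, then its integrated bound under the [G]-measurable weight
   [f]. *)
apply: (@le_trans _ _
    (\int[P]_(w in A) (f w * (a%:E + b%:E * neg_pow (X w) s0)))).
  apply: ge0_le_integral => //.
  - by move=> w _; exact: expeR_ge0.
  - apply: measurable_funTS; apply: (measurableT_comp (@measurable_expeR R)).
    apply: measurableT_comp => //; apply: measurable_funeM.
    apply: emeasurable_funB; first exact: (measurableT_comp (@measurable_lne R)).
    exact/measurable_EFinP.
  - exact/measurable_funTS/emeasurable_funM.
  - move=> w _; rewrite neg_powE// /f.
    by apply: expeR_affine_le; rewrite ?s_ge0.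
apply: (@le_trans _ _ (\int[P]_(w in A) (f w * cst (expR (th * l))%:E w))).
  apply: (integral_mul_le sG subG) => //.
  - by move=> w; rewrite lee_fin expR_ge0.
  - by move=> B GB; rewrite -abE; exact: integral_affine_neg_pow_le.
by rewrite le_eqVlt; apply/orP; left; apply/eqP; apply: eq_integral => w _;
  rewrite /f/= -EFinM -expRD.
Qed.

(** Jensen's inequality for the logarithm, from [neg_part_le_expeR]. The positive and negative parts
    of the logarithm stay on opposite sides until the real value [c] forces both conditional
    expectations to be finite. *)
Lemma ln_condexp_ge0 :
  {ae P, forall w (c : R),
    c%:E = condexp_signed P G (fun v => lne (X v)) w -> (0 <= ln rho + s0 * c)%R}.
Proof.
pose L := fun w => lne (X w).
have mL : measurable_fun setT L by exact: (measurableT_comp (@measurable_lne R)).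
have mLp := measurable_funepos mL; have mLn := measurable_funeneg mL.
have Lp0 w : 0 <= L^\+ w by exact: funepos_ge0.
have Ln0 w : 0 <= L^\- w by exact: funeneg_ge0.
have [GU U0 UE] := condexpP P sG subG mLp Lp0.
have [GV V0 VE] := condexpP P sG subG mLn Ln0.
set U := condexp P G L^\+ in GU U0 UE.
set V := condexp P G L^\- in GV V0 VE.
have mU := sub_measurable_fun subG GU; have mV := sub_measurable_fun subG GV.
have mN := measurable_neg_pow s0_gt0.
(* The positive and negative parts of [1 - ln rho], so that every integrand below is nonnegative. *)
pose p : R := Num.max (1 - ln rho)%R 0%R; pose m : R := Num.max (ln rho - 1)%R 0%R.
have p0 : (0 <= p)%R by rewrite le_max lexx orbT.
have m0 : (0 <= m)%R by rewrite le_max lexx orbT.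
have pm : (p - m = 1 - ln rho)%R.
  by rewrite /p /m /Num.max; case: ifPn; case: ifPn; rewrite -?leNgt => *; lra.
have ir0 : (0 <= rho^-1)%R by rewrite invr_ge0 ltW.
have s0_ge0 := ltW s0_gt0.
(* The extra 1 on the right is [rho^-1 * rho], the bound for the exponential term of the tangent
   inequality. *)
have : {ae P, forall w, p%:E + s0%:E * V w <= (1 + m)%:E + s0%:E * U w}.
  apply: (ae_le_of_integral_le sG subG).
  - apply: (sub_measurable_comp (g := fun x : \bar R => p%:E + s0%:E * x)) => //.
    by apply: emeasurable_funD => //; exact: measurable_funeM.
  - apply: (sub_measurable_comp (g := fun x : \bar R => (1 + m)%:E + s0%:E * x)) => //.
    by apply: emeasurable_funD => //; exact: measurable_funeM.
  - by move=> w; rewrite adde_ge0 ?mule_ge0 ?lee_fin// V0.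
  - by move=> w; rewrite adde_ge0 ?mule_ge0 ?lee_fin ?addr_ge0// U0.
  move=> A GA; have mA := subG GA.
  have intD (k : R) (Z : T -> \bar R) : (0 <= k)%R -> measurable_fun setT Z ->
      (forall w, 0 <= Z w) -> \int[P]_(w in A) (k%:E + s0%:E * Z w) =
      \int[P]_(w in A) cst k%:E w + s0%:E * \int[P]_(w in A) Z w.
    move=> k0 mZ Z0; rewrite ge0_integralD//; last 2 first.
    - by move=> w _; rewrite mule_ge0 ?lee_fin// Z0.
    - exact/measurable_funTS/measurable_funeM.
    by rewrite ge0_integralZl//; exact: measurable_funTS.
  rewrite !intD// ?addr_ge0// UE// VE// -!intD// ?addr_ge0//.
  apply: (@le_trans _ _ (\int[P]_(w in A)
      ((m%:E + rho^-1%:E * neg_pow (X w) s0) + s0%:E * L^\+ w))).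
    apply: ge0_le_integral => //.
    - by move=> w _; rewrite adde_ge0 ?mule_ge0 ?lee_fin.
    - apply/measurable_funTS/emeasurable_funD => //; exact: measurable_funeM.
    - apply/measurable_funTS/emeasurable_funD; last exact: measurable_funeM.
      by apply: emeasurable_funD => //; exact: measurable_funeM.
    - move=> w _; rewrite neg_powE// funeposE funenegE /L.
      rewrite (_ : (rho^-1)%R = expR (- ln rho)); last by rewrite expRN lnK.
      exact: neg_part_le_expeR.
  rewrite ge0_integralD//; last 4 first.
  - by move=> w _; rewrite adde_ge0 ?mule_ge0 ?lee_fin ?neg_pow_ge0.
  - apply/measurable_funTS/emeasurable_funD => //; exact: measurable_funeM.
  - by move=> w _; rewrite mule_ge0 ?lee_fin.
  - exact/measurable_funTS/measurable_funeM.
  rewrite ge0_integralZl//; last exact: measurable_funTS.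
  rewrite intD ?addr_ge0// leeD2r//.
  apply: le_trans (integral_affine_neg_pow_le m0 ir0 GA) _.
  by rewrite mulVf ?gt_eqF// addrC.
apply: filterS => w + c.
rewrite /condexp_signed -/U -/V => UV cE.
have := V0 w; have := U0 w; move: cE UV.
case: (U w) => [u| |//]; case: (V w) => [v| |//]//= cE + _ _.
move: cE => [->]; rewrite -!EFinM -!EFinD lee_fin => h.
by move: pm; lra.
Qed.

End OneStep.

(** * Wealth *)

Section Wealth.
Context d (T : measurableType d) (R : realType) (P : probability T R).
Variables (F : nat -> set (set T)) (E : nat -> T -> \bar R).
Hypothesis HF : filtration F.
Hypothesis EF : forall n, (0 < n)%N -> sub_measurable (F n) (E n).
Hypothesis E0 : forall n w, (0 < n)%N -> 0 <= E n w.

Let sF t : sigma_algebra setT (F t) := filtration_sigma HF t.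
Let subF t : F t `<=` measurable := @filtration_sub _ _ _ HF t.

Lemma measurable_bet n : (0 < n)%N -> measurable_fun setT (E n).
Proof. by move=> n0; apply: (sub_measurable_fun (@subF n)); exact: EF. Qed.

Lemma measurable_wealth t : measurable_fun setT (wealth E t).
Proof.
elim: t => [|t IH]; rewrite /wealth.
  under eq_fun do rewrite big_geq//.
  exact: measurable_cst.
under eq_fun do rewrite big_nat_recr//=.
apply: emeasurable_funM; first exact: IH.
exact: measurable_bet.
Qed.

Lemma measurable_wealth_le (a : \bar R) t :
  measurable [set w | wealth E t w <= a].
Proof.
rewrite -[X in measurable X]setTI.
by apply: measurable_lee => //; exact: measurable_wealth.
Qed.

Lemma tau_gt (alpha : R) (t : nat) (w : T) :
  ((t%:R : R)%:E < tau E alpha w) <->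
  forall n, (0 < n <= t)%N -> wealth E n w <= (alpha^-1)%:E.
Proof.
split=> [tlt n /andP[n0 nt]|H].
  rewrite leNgt; apply/negP => Wn.
  have : tau E alpha w <= (n%:R)%:E by apply: ereal_inf_lbound; exists n.
  by apply/negP; rewrite -ltNge (le_lt_trans _ tlt)// lee_fin ler_nat.
(* Crossing times are integers: without one up to [t], all are at least [t.+1], and so is their
   infimum, also when there is none. *)
apply: (@lt_le_trans _ _ (t.+1%:R)%:E); first by rewrite lte_fin ltr_nat.
apply: le_ereal_inf_tmp => _ [n [n0 Wn] <-]; rewrite lee_fin ler_nat ltnNge.
apply/negP => nt; move: Wn; rewrite ltNge => /negP; apply.
by apply: H; rewrite n0.
Qed.

(** No crossing up to [t] includes none at time [t] itself; this uses [0 < t], since crossings count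
    from time 1. *)
Lemma gamma_bar_le_gamma (alpha : R) (t : nat) : (0 < t)%N ->
  gamma_bar P E alpha t <= gamma P E alpha t.
Proof.
move=> t0; rewrite /gamma_bar /gamma.
have mW n := measurable_wealth_le (alpha^-1)%:E n.
apply: le_measure; rewrite ?inE//; last first.
  by move=> w /= /tau_gt; apply; rewrite t0 leqnn.
rewrite (_ : [set w | _] = \bigcap_(n in [set n | (0 < n <= t)%N])
    [set w | wealth E n w <= (alpha^-1)%:E]).
  exact: bigcap_measurableType.
by apply/seteqP; split => w /=; [move=> /tau_gt|move=> ?; apply/tau_gt].
Qed.

Variables (s0 : R) (rho : nat -> R).
Hypothesis s0_gt0 : (0 < s0)%R.
Hypothesis rho_gt0 : forall n, (0 < n)%N -> (0 < rho n)%R.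
Hypothesis Erho : forall n, (0 < n)%N ->
  {ae P, forall w,
    condexp P (F n.-1) (fun v => neg_pow (E n v) s0) w <= (rho n)%:E}.

(* Needed because 0 * +oo = 0: negative powers are not multiplicative on a path
   where one bet is 0 and another is +oo. *)
Lemma bet_gt0_ae n : (0 < n)%N -> {ae P, forall w, 0 < E n w}.
Proof.
move=> n0; have mE := measurable_bet n0.
have mN := measurable_neg_pow mE (fun w => E0 w n0) s0_gt0.
have iN : P.-integrable setT (fun w => neg_pow (E n w) s0).
  apply/integrableP; split => //.
  under eq_integral do rewrite gee0_abs ?neg_pow_ge0//.
  apply: le_lt_trans (integral_neg_pow_le (sF n.-1) (@subF n.-1) mE
    (fun w => E0 w n0) s0_gt0 (rho_gt0 n0) (Erho n0) _) _.
    exact/(measurable_g_sigma_algebraP (sF _))/measurableT.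
  by rewrite integral_cst// [X in _ * X](probability_setT P) mule1 ltry.
(* An integrable function is almost everywhere finite, whereas [neg_pow 0 s0] is [+oo]. *)
have := integrable_ae measurableT iN.
apply: filterS => w /(_ Logic.I) Nfin.
rewrite lt0e E0// andbT; apply/eqP => Ew; move: Nfin.
by rewrite Ew /neg_pow poweR0r ?gt_eqF// inve0.
Qed.

(** Positivity of the partial product is carried along because the induction step feeds it to
    [neg_powM]. *)
Lemma prod_neg_pow (x : nat -> \bar R) t :
  (forall n, (0 < n <= t)%N -> 0 < x n) ->
  0 < \prod_(1 <= n < t.+1) x n /\
  \prod_(1 <= n < t.+1) neg_pow (x n) s0 =
  neg_pow (\prod_(1 <= n < t.+1) x n) s0.
Proof.
elim: t => [_|t IH x0].
  rewrite !big_geq//; split => //.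
  by rewrite /neg_pow poweR1r inve1.
have [|W0 WE] := IH.
  by move=> n /andP[n0 nt]; apply: x0; rewrite n0 ltnW.
have xt0 : 0 < x t.+1 by apply: x0; rewrite /= leqnn.
rewrite !(big_nat_recr t.+1 1)//= WE -neg_powM//; split => //.
exact: mule_gt0.
Qed.

(** A product of powers, so that its recursion in [t] holds on every path; it is identified with the
    power of the wealth only on the almost sure event that all bets are positive. *)
Let M t w := \prod_(1 <= n < t.+1) neg_pow (E n w) s0.

Lemma prod_neg_pow_ge0 t w : 0 <= M t w.
Proof.
rewrite /M; elim/big_ind : _ => // [x y|n _]; first exact: mule_ge0.
exact: neg_pow_ge0.
Qed.

Lemma sub_measurable_prod_neg_pow t : sub_measurable (F t) (M t).
Proof.
elim: t => [|t IH]; apply/(sub_measurableP (sF _)); rewrite /M.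
  under eq_fun do rewrite big_geq//.
  exact: measurable_cst.
under eq_fun do rewrite big_nat_recr//=.
apply: emeasurable_funM; apply/(sub_measurableP (sF _)).
  by move=> B mB; apply: (filtration_mono HF (leqnSn t)); exact: IH.
under eq_fun do rewrite neg_powE// ?E0//.
apply: (sub_measurable_comp
  (g := fun x : \bar R => expeR (- (s0%:E * lne x)))); last exact: EF.
apply: (measurableT_comp (@measurable_expeR R)).
apply: measurableT_comp => //; apply: measurable_funeM.
exact: measurable_lne.
Qed.

(** Induction on [t]: the newest factor is replaced by its constant bound under the weight [M t],
    which is measurable for [F t]. *)
Lemma integral_prod_neg_pow_le t :
  \int[P]_w M t w <= (\prod_(1 <= n < t.+1) rho n)%:E.
Proof.
elim: t => [|t IH].
  rewrite /M; under eq_integral do rewrite big_geq//.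
  by rewrite big_geq// integral_cst// [X in _ * X](probability_setT P) mule1.
have mE := measurable_bet (ltn0Sn t).
have E0t w : 0 <= E t.+1 w by exact: E0.
have GM := sub_measurable_prod_neg_pow t.
have mM := sub_measurable_fun (@subF t) GM.
have rt0 := rho_gt0 (ltn0Sn t).
under eq_integral do rewrite /M big_nat_recr//= -/(M _ _).
apply: (@le_trans _ _ (\int[P]_w (M t w * cst (rho t.+1)%:E w))).
  apply: (integral_mul_le (sF t) (@subF t)) => //.
  - by move=> w; exact: prod_neg_pow_ge0.
  - exact: measurable_neg_pow.
  - by move=> w; exact: neg_pow_ge0.
  - by move=> w; rewrite lee_fin ltW.
  - move=> B GB.
    exact: (integral_neg_pow_le (sF t) (@subF t) mE E0t s0_gt0 rt0
      (Erho (ltn0Sn t))).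
  - exact/(measurable_g_sigma_algebraP (sF _))/measurableT.
under eq_integral do rewrite muleC.
rewrite ge0_integralZl//; last 2 first.
- by move=> w _; exact: prod_neg_pow_ge0.
- by rewrite lee_fin ltW.
by rewrite big_nat_recr//= mulrC EFinM lee_wpmul2l// lee_fin ltW.
Qed.

(** Markov's inequality: on the event [B], [M t] is almost surely at least [alpha] to the power
    [s0]. *)
Lemma gamma_le (alpha : R) t : (0 < alpha)%R ->
  gamma P E alpha t <= (alpha `^ (- s0) * \prod_(1 <= n < t.+1) rho n)%R%:E.
Proof.
move=> a0; rewrite /gamma; set B := [set w | _].
have mB : measurable B by exact: measurable_wealth_le.
have mM := sub_measurable_fun (@subF t) (sub_measurable_prod_neg_pow t).
have as0 : (0 < alpha `^ s0)%R by exact: powR_gt0.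
have : (alpha `^ s0)%:E * P B <= (\prod_(1 <= n < t.+1) rho n)%:E.
  rewrite -integral_cst//.
  apply: le_trans (integral_prod_neg_pow_le t).
  apply: (@le_trans _ _ (\int[P]_(w in B) M t w)); last first.
    by apply: ge0_subset_integral => // w _; exact: prod_neg_pow_ge0.
  apply: ae_ge0_le_integral => //.
  - by move=> w _; rewrite lee_fin ltW.
  - by move=> w _; exact: prod_neg_pow_ge0.
  - exact: measurable_funTS.
  (* A countable intersection gives positivity of all bets at once, so [prod_neg_pow] applies path
     by path. *)
  have : {ae P, forall w n, (0 < n)%N -> 0 < E n w}.
    apply: ae_foralln => -[|n]; first exact: aeW.
    by apply: filterS (bet_gt0_ae (ltn0Sn n)) => w.
  apply: filterS => w En Bw.
  have [W0 WE] := @prod_neg_pow (E^~ w) t (fun n nt => En n (proj1 (andP nt))).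
  rewrite /M WE.
  move: Bw W0; rewrite /B/= /wealth; case: (\prod_(_ <= n < _) _) => [r| |]//.
  rewrite lee_fin lte_fin => ra r0.
  rewrite /neg_pow poweR_EFin inver gt_eqF ?powR_gt0// lee_fin.
  rewrite -[leLHS]invrK lef_pV2 ?posrE ?invr_gt0 ?powR_gt0//.
  have -> : ((alpha `^ s0)^-1 = alpha^-1 `^ s0)%R.
    by rewrite -(powR_inv1 (ltW a0)) -powRrM mulN1r powRN.
  by rewrite ge0_ler_powR ?nnegrE ?invr_ge0// ltW.
rewrite powRN EFinM lee_pdivlMl//.
Qed.

End Wealth.

(** * Rate function of the chord *)

Section ChordRate.
Context (R : realType).
Variables (s0 : R) (K : nat -> R) (t : nat).
Hypothesis s0_gt0 : (0 < s0)%R.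

(** The objective is linear in [s] on [0, [s0]] and [-oo] beyond, so its maximum is reached at an
    endpoint, chosen by the sign of the slope. *)
Lemma chord_gain (x s : R) :
  (s * x)%:E - chord_aggregate s0 K t s =
  if (s <= s0)%R then (s / s0 * (s0 * x - K t))%:E else -oo.
Proof.
rewrite /chord_aggregate; case: ifPn => // _.
by rewrite -EFinB; congr EFin; field; rewrite gt_eqF.
Qed.

Lemma rate_function_chord (x : R) :
  rate_function (chord_aggregate s0 K t) x = (Num.max (s0 * x - K t) 0)%:E.
Proof.
apply/eqP; rewrite eq_le; apply/andP; split.
  apply: ge_ereal_sup => _ [s s_ge0 <-]; rewrite chord_gain.
  case: ifPn => [ss0|_]; last by rewrite leNye.
  rewrite lee_fin le_max.
  have th0 : (0 <= s / s0)%R by rewrite divr_ge0// ltW.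
  have th1 : (s / s0 <= 1)%R by rewrite ler_pdivrMr// mul1r.
  have [h|h] := leP 0%R (s0 * x - K t)%R.
    by apply/orP; left; rewrite -[leRHS]mul1r ler_wpM2r.
  by apply/orP; right; rewrite mulr_ge0_le0// ltW.
rewrite /Num.max; case: ifPn => _; apply: ereal_sup_ubound.
- by exists 0%R => //=; rewrite chord_gain ltW// mul0r mul0r.
- by exists s0; rewrite /= ?ltW// chord_gain lexx divff ?gt_eqF// mul1r.
Qed.

Lemma optimising_tilt_chord (x : R) :
  optimising_tilt (chord_aggregate s0 K t) x
    (if (K t < s0 * x)%R then s0 else 0%R).
Proof.
have [h|h] := ltP (K t) (s0 * x)%R; split=> //; rewrite ?ltW//;
  rewrite chord_gain rate_function_chord.
  rewrite lexx divff ?gt_eqF// mul1r; congr EFin.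
  by apply/esym/max_idPl; rewrite subr_ge0 ltW.
rewrite ltW// mul0r mul0r; congr EFin.
by apply/esym/max_idPr; rewrite subr_le0.
Qed.

(** A nonzero slope leaves a single maximising endpoint; with slope 0 every point of [0, [s0]] is a
    maximiser. *)
Lemma optimising_tilt_chord_unique (x s : R) : (s0 * x)%R <> K t ->
  optimising_tilt (chord_aggregate s0 K t) x s ->
  s = if (K t < s0 * x)%R then s0 else 0%R.
Proof.
move=> xK [s_ge0]; rewrite chord_gain rate_function_chord.
case: ifPn => // ss0 [].
have D0 : (s0 * x - K t)%R != 0%R by rewrite subr_eq0; exact/eqP.
case: ifPn => h.
  rewrite (max_idPl _); last by rewrite subr_ge0 ltW.
  rewrite -[X in _ = X -> _]mul1r => /(mulIf D0) th1.
  by apply: (mulIf (invr_neq0 (lt0r_neq0 s0_gt0))); rewrite th1 divff ?gt_eqF.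
rewrite (max_idPr _); last by rewrite subr_le0 leNgt.
by move/eqP; rewrite !mulf_eq0 (negPf D0) orbF invr_eq0 [s0 == _]gt_eqF// orbF => /eqP.
Qed.

End ChordRate.

(** * Deterministic constants and the final bounds *)

Lemma prod_gt0_sum_ln (R : realType) (rho : nat -> R) t :
  (forall n, (0 < n)%N -> (0 < rho n)%R) ->
  (0 < \prod_(1 <= n < t.+1) rho n)%R /\
  (\sum_(1 <= n < t.+1) ln (rho n) = ln (\prod_(1 <= n < t.+1) rho n))%R.
Proof.
move=> rho_gt0; elim: t => [|t [IH0 IH]].
  by rewrite !big_geq// ln1 ltr01.
have rt := rho_gt0 _ (ltn0Sn t).
by rewrite !(big_nat_recr t.+1 1)//= IH lnM ?posrE// mulr_gt0.
Qed.

Lemma sum_kappa d (T : measurableType d) (R : realType) (rho : nat -> R)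
    (s0 : R) (c : nat -> T -> R) t w :
  (\sum_(1 <= n < t.+1) kappa rho s0 c n w =
   \sum_(1 <= n < t.+1) ln (rho n) + s0 * \sum_(1 <= n < t.+1) c n w)%R.
Proof. by rewrite mulr_sumr -big_split. Qed.

(** A space of mass 1 is not negligible. Evaluating almost sure relations at one common point yields
    relations between the deterministic constants. *)
Lemma ae_exists d (T : measurableType d) (R : realType) (P : probability T R)
    (Q : T -> Prop) : {ae P, forall w, Q w} -> exists w, Q w.
Proof.
move=> aeQ; apply: contrapT => nQ.
have /negligibleP : P.-negligible [set: T].
  by apply: negligibleS aeQ => w _ /= Qw; apply: nQ; exists w.
move=> /(_ measurableT) P0; have : 1 = 0 :> \bar R.
  by rewrite -[LHS](probability_setT P); exact: P0.
by move/eqP; rewrite onee_eq0.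
Qed.

Unset Implicit Arguments.
Set Strict Implicit.

Theorem corollary4p3 (R : realType) (d : measure_display)
    (T : measurableType d) (F : nat -> set (set T)) (P0 P1 : probability T R)
    (E : nat -> T -> \bar R) (c : nat -> T -> R) (C : nat -> R)
    (s0 : R) (rho : nat -> R) (K : nat -> R)
    (HF : filtration F)
    (HP : locally_dominated F P1 P0)
    (HE : betting_sequence F P0 E)
    (Hc : drift_certificate F P1 E c)
    (HC : forall t, (0 < t)%N ->
      {ae P1, forall w, (C t <= \sum_(1 <= n < t.+1) c n w)%R})
    (Hs0 : (0 < s0)%R)
    (Hrho : forall n, (0 < n)%N -> (0 < rho n)%R)
    (Hneg : forall n, (0 < n)%N ->
      {ae P1, forall w,
        condexp P1 (F n.-1) (fun v => neg_pow (E n v) s0) w <= (rho n)%:E})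
    (HK0 : forall t, (0 < t)%N -> (0 <= K t)%R)
    (HK : forall t, (0 < t)%N ->
      {ae P1, forall w,
        (\sum_(1 <= n < t.+1) kappa rho s0 c n w <= K t)%R}) :
  [/\ (* Jensen: kappa_n >= 0 wherever the drift certificate is attained *)
      (forall n, (0 < n)%N ->
        {ae P1, forall w,
          (c n w)%:E = condexp_signed P1 (F n.-1) (log_increment E n) w ->
          (0 <= kappa rho s0 c n w)%R}),
      (* the chord dominates phi_n, and is a majorant when kappa_n >= 0 *)
      (forall n s, (0 < n)%N -> (0 <= s)%R ->
        {ae P1, forall w,
          phi F P1 E c n s w <= chord s0 (kappa rho s0 c) n s w})
      /\ (forall n s w, (0 < n)%N -> (0 <= s)%R ->
            (0 <= kappa rho s0 c n w)%R ->
            0 <= chord s0 (kappa rho s0 c) n s w)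
      /\ ((forall n, (0 < n)%N ->
            {ae P1, forall w, (0 <= kappa rho s0 c n w)%R}) ->
          majorant F P1 E c (chord s0 (kappa rho s0 c))),
      aggregate P1 c (chord s0 (kappa rho s0 c)) C (chord_aggregate s0 K),
      (forall t (x : R), (0 < t)%N -> (0 <= x)%R ->
        rate_function (chord_aggregate s0 K t) x =
        (Num.max (s0 * x - K t) 0)%:E) &
      (forall (alpha : R) t, (0 < alpha < 1)%R -> (0 < t)%N ->
        [/\ (* the tilt is unique except when s0 * Delta_t = K_t *)
            let tilt := if (K t < s0 * Delta C alpha t)%R then s0 else 0%R in
            optimising_tilt (chord_aggregate s0 K t) (Delta C alpha t) tilt
            /\ ((s0 * Delta C alpha t)%R <> K t ->
                forall s,
                  optimising_tilt (chord_aggregate s0 K t) (Delta C alpha t) s ->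
                  s = tilt),
            gamma_bar P1 E alpha t <= gamma P1 E alpha t,
            gamma P1 E alpha t <=
              (Num.min 1 (expR (K t - s0 * Delta C alpha t)))%:E,
            gamma P1 E alpha t <=
              (Num.min 1
                 (alpha `^ (- s0) * \prod_(1 <= n < t.+1) rho n)%R)%:E &
            (* with K_t and C_t equal to the sums, the two bounds coincide *)
            {ae P1, forall w, (C t = \sum_(1 <= n < t.+1) c n w)%R} ->
            {ae P1, forall w,
              (K t = \sum_(1 <= n < t.+1) kappa rho s0 c n w)%R} ->
            (Num.min 1 (expR (K t - s0 * Delta C alpha t)) =
             Num.min 1
               (alpha `^ (- s0) * \prod_(1 <= n < t.+1) rho n))%R])].
Proof.
have sF t := filtration_sigma HF t.
have subF t := @filtration_sub _ _ _ HF t.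
have EF := betting_adapted HE.
have E0 : forall n w, (0 < n)%N -> 0 <= E n w by exact: (betting_ge0 HE).
have mE n : (0 < n)%N -> measurable_fun setT (E n).
  by move=> n0; exact: (measurable_bet HF EF n0).
have Gc n : (0 < n)%N -> sub_measurable (F n.-1) (c n).
  by move=> n0; exact: (drift_predictable Hc n0).
have s0_ge0 := ltW Hs0.
have ath s : (0 <= s)%R -> (0 <= s / s0)%R by move=> s_ge0; rewrite divr_ge0.
have phi_le n s : (0 < n)%N -> (0 <= s)%R ->
    {ae P1, forall w,
      phi F P1 E c n s w <= chord s0 (kappa rho s0 c) n s w}.
  move=> n0 s_ge0; have [ss0|ss0] := leP s s0; last first.
    by apply: aeW => w; rewrite /chord ifN ?leey// -ltNge.
  have sb : (0 <= s <= s0)%R by rewrite s_ge0.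
  have := condexp_exp_le (sF n.-1) (subF n.-1) (mE n n0)
    (fun w => E0 n w n0) Hs0 (Hrho n n0) (Hneg n n0) (Gc n n0) sb.
  apply: filterS => w; set Y := condexp _ _ _ w => h.
  rewrite /phi /log_increment -/Y /chord ss0.
  have -> : (s / s0 * kappa rho s0 c n w)%:E =
      lne (expeR (s * c n w + s / s0 * ln (rho n))%:E).
    by rewrite expeRK /kappa; congr EFin; field; rewrite gt_eqF.
  (* At [Y <= 0] the logarithm is [-oo]; otherwise [lne] is monotone. *)
  have [Y0|Y0] := leP Y 0; first by rewrite le0_lneNy// leNye.
  by rewrite lee_lne ?in_itv/= ?(ltW Y0) ?leey ?lee_fin ?expR_ge0.
have chord_ge0 n s w : (0 < n)%N -> (0 <= s)%R ->
    (0 <= kappa rho s0 c n w)%R -> 0 <= chord s0 (kappa rho s0 c) n s w.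
  move=> n0 s_ge0 k0; rewrite /chord; case: ifPn => // _.
  by rewrite lee_fin mulr_ge0// ath.
split.
- move=> n n0.
  have := ln_condexp_ge0 (sF n.-1) (subF n.-1) (mE n n0)
    (fun w => E0 n w n0) Hs0 (Hrho n n0) (Hneg n n0).
  by apply: filterS => w h cE; exact: h cE.
- split=> //; split=> // kap0; split=> //.
  + move=> n s n0 s_ge0.
    rewrite (_ : chord s0 (kappa rho s0 c) n s =
      (fun x : R => if (s <= s0)%R then (s / s0 * (ln (rho n) + s0 * x))%:E
                    else +oo) \o c n)//.
    apply: sub_measurable_comp; last exact: Gc.
    case: (s <= s0)%R; last exact: measurable_cst.
    apply/measurable_EFinP; apply: measurable_funM => //.
    by apply: measurable_funD => //; exact: measurable_funM.
  + move=> n s n0 s_ge0; move: (kap0 n n0).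
    by apply: filterS => w; exact: chord_ge0.
  + by move=> n w n0; rewrite /chord s0_ge0 mul0r mul0r.
- split=> //.
  + move=> t s t0 s_ge0; rewrite /chord_aggregate; case: ifPn => // _.
    by rewrite lee_fin mulr_ge0 ?ath// HK0.
  + move=> t s t0 s_ge0; have [ss0|ss0] := leP s s0; last first.
      by apply: aeW => w; rewrite /chord_aggregate ifN ?leey// -ltNge.
    move: (HK t t0); apply: filterS => w h.
    rewrite /chord_aggregate /chord ss0.
    by rewrite sumEFin lee_fin -mulr_sumr ler_wpM2l// ath.
- by move=> t x t0 x0; exact: rate_function_chord.
move=> alpha t /andP[a0 a1] t0.
have [prod0 lnprod] := prod_gt0_sum_ln (rho := rho) t Hrho.
set Q := (\prod_(1 <= n < t.+1) rho n)%R in prod0 lnprod *.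
(* Puts both bounds in exponential form, so that only exponents have to be compared. *)
have aQE : (alpha `^ (- s0) * Q = expR (s0 * log_threshold alpha + ln Q))%R.
  rewrite expRD lnK ?posrE// /powR gt_eqF// /log_threshold lnV ?posrE//.
  by rewrite mulrN mulNr.
have gle1 : gamma P1 E alpha t <= 1.
  exact/probability_le1/(measurable_wealth_le HF EF).
have gle : gamma P1 E alpha t <= (alpha `^ (- s0) * Q)%R%:E.
  exact: (gamma_le HF EF E0 Hs0 Hrho Hneg).
have Kt0 := HK0 t t0.
have KC : (ln Q <= K t - s0 * C t)%R.
  have /ae_exists[w [h1 h2]] : {ae P1, forall w,
      (C t <= \sum_(1 <= n < t.+1) c n w)%R /\
      (\sum_(1 <= n < t.+1) kappa rho s0 c n w <= K t)%R}.
    move: (HC t t0) (HK t t0); apply: filterS2 => w ? ?; split=> //.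
  move: h2; rewrite sum_kappa lnprod => h2.
  by have := ler_wpM2l s0_ge0 h1; lra.
split.
- split; first exact: optimising_tilt_chord.
  by move=> h s; exact: optimising_tilt_chord_unique.
- exact: (gamma_bar_le_gamma P1 HF EF).
- rewrite EFin_min le_min gle1/= /Delta.
  (* If [Delta] is 0, the bound is [expR (K t) >= 1] and holds trivially; otherwise [KC] compares
     the exponents. *)
  have [Cl|Cl] := leP (C t - log_threshold alpha)%R 0%R.
    rewrite (le_trans gle1)// lee_fin mulr0 subr0.
    by rewrite -expR0 ler_expR.
  apply: (le_trans gle); rewrite lee_fin aQE ler_expR.
  by lra.
- by rewrite EFin_min le_min gle1.
move=> CE KE.
have KQ : (K t = ln Q + s0 * C t)%R.
  have /ae_exists[w [h1 h2]] : {ae P1, forall w,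
      (C t = \sum_(1 <= n < t.+1) c n w)%R /\
      (K t = \sum_(1 <= n < t.+1) kappa rho s0 c n w)%R}.
    by move: CE KE; apply: filterS2 => w ? ?; split.
  by rewrite h2 sum_kappa lnprod -h1.
rewrite aQE /Delta.
(* If [Delta] is 0, both exponents are nonnegative and both minima are 1: by [KQ] the second one is
   [K t + s0 * (log_threshold alpha - C t)]. *)
have [Cl|Cl] := leP (C t - log_threshold alpha)%R 0%R.
  rewrite mulr0 subr0 !(min_idPl _)// -expR0 ler_expR//.
  have : (s0 * (C t - log_threshold alpha) <= 0)%R by rewrite mulr_ge0_le0.
  by lra.
by congr (Num.min _ (expR _)); rewrite KQ; ring.
Qed.
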